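(* Let $F,g:\mathbb R\to\mathbb R$ satisfy (H1) and (H2) of the context, and consider the Liénard system $$\dot x=y-F(x),\qquad \dot y=-g(x).$$ With $a$, $c$, $I$ and $Y$ as in the context, let $v_0$ be the positive zero of $v\mapsto I(v,-a,c)$. If $$\min\left\{Y\left(0;-a,F(c)\right),\,Y\left(0;c,F(c)\right)\right\}\le v_0+F(c),$$ then $$Y\left(0;-a,F(c)\right)\ge Y\left(0;c,F(c)\right).$$
   Context: Hypothesis (H1): $F$ and $g$ are odd functions in $C^1(\mathbb R)$, $g(x)>0$ for $x>0$, $F'(0)<0$, $F'$ has a unique positive zero, located at $x=a$, and $\lim_{x\to+\infty}F(x)=+\infty$. Under (H1), $F$ is strictly decreasing on $(-a,a)$ and strictly increasing elsewhere, $F$ has a unique positive zero $b>a$, and the equation $F(x)=F(-a)$ has a unique positive root $c$, with $c>b$. Hypothesis (H2): $F'(x)/g(x)$ is nondecreasing on $(0,c)$. For $v>0$ let $\bar\zeta(v)>c$ be the unique real root of $F(x)-F(c)=v$. For $v>0$ and $x,u<\bar\zeta(v)$ define $$I(v,x,u):=\int_x^u\frac{g(s)}{F(s)-F(c)-v}\,\mathrm ds.$$ Under (H1) and (H2), the function $v\mapsto I(v,-a,c)$ has exactly one zero $v_0$ in $(0,+\infty)$. Orbit graphs: the orbit segments of the system lying above the curve $L_F=\{(x,y): y=F(x)\}$ are graphs over $x$. For $(x_0,y_0)\neq(0,0)$ with $y_0\ge F(x_0)$, $y=Y(x;x_0,y_0)$ denotes the graph of the orbit segment above $L_F$ through $(x_0,y_0)$;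 when $y_0=F(x_0)$, it denotes the adjacent orbit segment above $L_F$ having $(x_0,y_0)$ as an endpoint (this segment leaves the endpoint in forward time if $x_0<0$ and in backward time if $x_0>0$). Note that $F(-a)=F(c)$, so $(-a,F(c))$ and $(c,F(c))$ both lie on $L_F$. *)

(* Defs.v *)
From Stdlib Require Import Reals.
From Coquelicot Require Import Coquelicot.
Open Scope R_scope.

Definition odd_fun (f : R -> R) : Prop := forall x, f (- x) = - f x.

Definition C1 (f : R -> R) : Prop :=
  forall x, ex_derive f x /\ continuous (Derive f) x.

Definition H1 (F g : R -> R) (a : R) : Prop :=
  odd_fun F /\ odd_fun g /\ C1 F /\ C1 g /\
  (forall x, 0 < x -> 0 < g x) /\
  Derive F 0 < 0 /\
  (0 < a /\ Derive F a = 0 /\ (forall x, 0 < x -> Derive F x = 0 -> x = a)) /\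
  is_lim F p_infty p_infty.

(* Under [H1] exactly one [c] satisfies this. *)
Definition is_c (F : R -> R) (a c : R) : Prop := 0 < c /\ F c = F (- a).

Definition H2 (F g : R -> R) (c : R) : Prop :=
  forall x y, 0 < x -> x <= y -> y < c -> Derive F x / g x <= Derive F y / g y.

(* Meaningful only when the denominator has no zero between [x] and [u]; this
   holds for [v > 0], [x = -a], [u = c] under [H1] and [is_c]. *)
Definition I_int (F g : R -> R) (c v x u : R) : R :=
  RInt (fun s => g s / (F s - F c - v)) x u.

Definition lienard_solution (F g X Z : R -> R) (s1 s2 : R) : Prop :=
  forall t, s1 <= t <= s2 ->
    is_derive X t (Z t - F (X t)) /\ is_derive Z t (- g (X t)).

(* [is_Y F g x0 y0 x y] means y = Y(x; x0, y0): the point (x, y) lies on the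
   orbit segment above the curve y = F(x) that passes through, or has as an
   endpoint, (x0, y0).  The relation is functional in [x] (X is strictly
   increasing in time above the curve) and partial.  Time may run either way
   from [t0] to [t1]; when y0 = F(x0), being strictly above the curve at
   intermediate times forces t0 <= t1 if x0 < 0 and t1 <= t0 if x0 > 0. *)
Definition is_Y (F g : R -> R) (x0 y0 x y : R) : Prop :=
  (x0, y0) <> (0, 0) /\ F x0 <= y0 /\
  exists (X Z : R -> R) (t0 t1 : R),
    lienard_solution F g X Z (Rmin t0 t1) (Rmax t0 t1) /\
    X t0 = x0 /\ Z t0 = y0 /\ X t1 = x /\ Z t1 = y /\
    (forall t, Rmin t0 t1 < t < Rmax t0 t1 -> F (X t) < Z t).

(* Main.v *)
(** Put V = v0 + F(c) and let P be a primitive of g / (V - F), so that P(-a) = P(c).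
    Suppose Y_l < Y_r for the two heights at x = 0; then Y_l <= V.  Let y_l on [-a, 0] and
    y_r on [0, c] be the two orbit graphs, and for x in [-a, 0] let tau(x) in (a, c] be the
    point with F(tau x) = F(x).

    By (H2) there are x0 in (-a, 0) and k > 0 with g <= k F' on [-a, x0] and on [tau x0, c],
    and g >= k F' on [x0, tau x0].  Since (y - k ln (k + y - F))' = (k F' - g) / (k + y - F)
    along orbits, y_r(tau x) <= y_l(x) on [-a, x0].  Follow this inequality up to the first
    contact m in [x0, 0] of the two sides, or up to m = 0.  Along an orbit,
    (P + y + (V - y)^2 / (2 (V - F)))' = (V - y)^2 F' / (2 (V - F)^2), so the difference of
    these quantities at x for y_l and at tau(x) for y_r is nondecreasing on [-a, m], and it
    vanishes at -a.
    - At a contact this says P(m) >= P(tau m), against (P + k ln (V - F))' >= 0 on [m, tau m],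
      which is strict on (0, a).
    - If m = 0 it says P(0) - P(b) >= (y_r(b)^2 - Y_l^2) / (2 V), where b = tau(0).  Choose
      xi in (0, b] with y_r(xi) = Y_l; since F <= 0 and y_r <= V on [xi, b], the function
      P + y_r^2 / (2 V) is nondecreasing there, and P(xi) > P(0), a contradiction. *)

Require Import Defs.
From Stdlib Require Import Reals Lra Ranalysis5 IndefiniteDescription.
From Coquelicot Require Import Coquelicot.
Open Scope R_scope.

(** * Calculus on an interval: monotonicity, intermediate values, first zeros, inverses *)

Lemma is_derive_continuity_pt (f : R -> R) (x l : R) :
  is_derive f x l -> continuity_pt f x.
Proof.
  intros H. apply continuity_pt_filterlim.
  apply (ex_derive_continuous (K := R_AbsRing) (V := R_NormedModule)).
  now exists l.
Qed.

(** Only continuity is asked at the endpoints, since an orbit graph has a vertical tangent where it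
    ends on the curve y = F(x) away from x = 0. *)
Lemma nondecreasing_of_derive (f : R -> R) (p q : R) :
  p <= q -> (forall x, p <= x <= q -> continuity_pt f x) ->
  (forall x, p < x < q -> exists l, is_derive f x l /\ 0 <= l) -> f p <= f q.
Proof.
  intros [hpq | <-] hc hd; [|lra].
  (* [MVT_gen] may return an endpoint; the default 0 keeps the sign there. *)
  set (df := fun x => if Rlt_dec p x then if Rlt_dec x q then Derive f x else 0 else 0).
  destruct (MVT_gen f p q df) as [z [hz e]].
  - rewrite Rmin_left, Rmax_right by lra. intros x hx. unfold df.
    destruct (Rlt_dec p x); [|lra]. destruct (Rlt_dec x q); [|lra].
    destruct (hd x hx) as [l [hl _]]. now rewrite (is_derive_unique _ _ _ hl).
  - rewrite Rmin_left, Rmax_right by lra. exact hc.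
  - assert (0 <= df z).
    { unfold df. destruct (Rlt_dec p z); [|lra]. destruct (Rlt_dec z q); [|lra].
      destruct (hd z) as [l [hl ?]]; [lra|]. now rewrite (is_derive_unique _ _ _ hl). }
    nra.
Qed.

Lemma increasing_of_derive (f : R -> R) (p q : R) :
  p < q -> (forall x, p <= x <= q -> continuity_pt f x) ->
  (forall x, p < x < q -> exists l, is_derive f x l /\ 0 < l) -> f p < f q.
Proof.
  intros hpq hc hd.
  set (df := fun x => if Rlt_dec p x then if Rlt_dec x q then Derive f x else 1 else 1).
  destruct (MVT_gen f p q df) as [z [hz e]].
  - rewrite Rmin_left, Rmax_right by lra. intros x hx. unfold df.
    destruct (Rlt_dec p x); [|lra]. destruct (Rlt_dec x q); [|lra].
    destruct (hd x hx) as [l [hl _]]. now rewrite (is_derive_unique _ _ _ hl).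
  - rewrite Rmin_left, Rmax_right by lra. exact hc.
  - assert (0 < df z).
    { unfold df. destruct (Rlt_dec p z); [|lra]. destruct (Rlt_dec z q); [|lra].
      destruct (hd z) as [l [hl ?]]; [lra|]. now rewrite (is_derive_unique _ _ _ hl). }
    nra.
Qed.

Lemma IVT_closed (f : R -> R) (p q y : R) :
  p <= q -> (forall x, p <= x <= q -> continuity_pt f x) ->
  f p <= y <= f q -> exists x, p <= x <= q /\ f x = y.
Proof.
  intros hpq hc [h1 h2].
  destruct (Req_dec (f p) y) as [e|n1]; [exists p; split; [lra|easy]|].
  destruct (Req_dec (f q) y) as [e|n2]; [exists q; split; [lra|easy]|].
  assert (p <> q) by (intros ->; lra).
  destruct (IVT_interv (fun x => f x - y) p q) as [x [hx e]]; try lra.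
  - intros x hx. apply continuity_pt_minus; [now apply hc|].
    apply continuity_pt_const. now intros ? ?.
  - exists x. split; [easy|lra].
Qed.

(** [m] is the supremum of the points up to which [f] stays nonnegative; if [f m] were nonzero and
    [m < q], continuity would push the supremum further. *)
Lemma first_zero (f : R -> R) (p q : R) :
  p <= q -> (forall x, p <= x <= q -> continuity_pt f x) -> 0 <= f p ->
  exists m, p <= m <= q /\ (forall x, p <= x <= m -> 0 <= f x) /\ (m = q \/ f m = 0).
Proof.
  intros hpq hc hp.
  set (S := fun m => p <= m <= q /\ forall x, p <= x <= m -> 0 <= f x).
  assert (Sp : S p).
  { split; [lra|]. intros x hx. replace x with p by lra. easy. }
  destruct (completeness S) as [m [ub lub]].
  - exists q. intros x [hx _]. lra.
  - now exists p.
  - assert (hm : p <= m <= q).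
    { split; [now apply ub|]. apply lub. intros x [hx _]. lra. }
    assert (below : forall x, p <= x < m -> 0 <= f x).
    { intros x hx. destruct (Rle_or_lt 0 (f x)) as [|neg]; [easy|].
      assert (m <= x); [|lra]. apply lub. intros z [hz1 hz2].
      destruct (Rle_or_lt z x); [easy|]. specialize (hz2 x). lra. }
    (* Near [m] the function keeps the sign of [f m]; the product form covers both signs. *)
    assert (sgn : f m <> 0 -> exists d, 0 < d /\
              forall x, Rabs (x - m) < d -> 0 < f x * f m).
    { intros hn. destruct (hc m hm (Rabs (f m))) as [d [hd H]].
      { now apply Rabs_pos_lt. }
      exists d. split; [easy|]. intros x hx.
      destruct (Req_dec x m) as [->|ne]; [nra|].
      specialize (H x). simpl in H. unfold R_dist, D_x, no_cond in H.
      assert (Rabs (f x - f m) < Rabs (f m)) as H'.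
      { apply H. repeat split; auto. }
      revert H'. unfold Rabs. destruct (Rcase_abs (f m)); destruct (Rcase_abs (f x - f m)); nra. }
    assert (fm : 0 <= f m).
    { destruct (Rle_or_lt 0 (f m)) as [|neg]; [easy|].
      destruct sgn as [d [hd H]]; [lra|].
      destruct (Req_dec m p) as [->|ne]; [lra|].
      set (x := Rmax p (m - d / 2)).
      assert (p <= x < m /\ m - x < d).
      { unfold x, Rmax. destruct (Rle_dec p (m - d / 2)); lra. }
      assert (0 < f x * f m).
      { apply H. rewrite Rabs_left; lra. }
      assert (0 <= f x) by (apply below; lra). nra. }
    assert (le : forall x, p <= x <= m -> 0 <= f x).
    { intros x hx. destruct (Req_dec x m) as [->|]; [easy|]. apply below. lra. }
    exists m. split; [easy|]. split; [easy|].
    destruct (Req_dec m q) as [|nq]; [now left|]. right.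
    destruct (Req_dec (f m) 0) as [|n0]; [easy|].
    destruct (sgn n0) as [d [hd H]].
    set (z := Rmin q (m + d / 2)).
    assert (hz : m < z <= q /\ z - m < d).
    { unfold z, Rmin. destruct (Rle_dec q (m + d / 2)); lra. }
    assert (z <= m); [|lra]. apply ub. split; [lra|].
    intros x hx. destruct (Rle_or_lt x m); [apply le; lra|].
    assert (0 < f x * f m).
    { apply H. rewrite Rabs_right; lra. }
    nra.
Qed.

(** Serves twice: to express time by position along an orbit, and to invert F on [a, c]. In both
    uses the derivative may vanish at an endpoint, hence the separate condition in the derivative
    formula. *)
Lemma increasing_inverse (f : R -> R) (p q : R) :
  p < q -> (forall x, p <= x <= q -> ex_derive f x) ->
  (forall x y, p <= x -> x < y -> y <= q -> f x < f y) ->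
  exists h : R -> R,
    (forall x, f p <= x <= f q -> p <= h x <= q /\ f (h x) = x /\ continuity_pt h x) /\
    (forall x, f p < x < f q -> Derive f (h x) <> 0 -> is_derive h x (/ Derive f (h x))).
Proof.
  intros hpq hd hinc.
  assert (hc : forall x, p <= x <= q -> continuity_pt f x).
  { intros x hx. eapply is_derive_continuity_pt. now apply Derive_correct, hd. }
  (* Extending [f] with slope 1 outside [p, q] makes the inverse continuous at the endpoints too. *)
  set (cl := fun t => Rmax p (Rmin t q)).
  set (ft := fun t => f (cl t) + (t - cl t)).
  assert (cl_in : forall t, p <= cl t <= q).
  { intros t. unfold cl, Rmax, Rmin. destruct (Rle_dec t q); destruct (Rle_dec p _); lra. }
  assert (cl_id : forall t, p <= t <= q -> cl t = t).
  { intros t ht. unfold cl. rewrite Rmin_left, Rmax_right; lra. }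
  assert (ft_id : forall t, p <= t <= q -> ft t = f t).
  { intros t ht. unfold ft. rewrite cl_id; lra. }
  assert (ft_inc : forall s t, s < t -> ft s < ft t).
  { intros s t hst. unfold ft.
    assert (cl s <= cl t /\ s - cl s <= t - cl t) as [h1 h2].
    { unfold cl, Rmax, Rmin. destruct (Rle_dec s q), (Rle_dec t q);
        repeat destruct (Rle_dec p _); lra. }
    destruct h1 as [h1 | e].
    - assert (f (cl s) < f (cl t)); [|lra]. apply hinc; try apply cl_in. easy.
    - rewrite e in h2 |- *. lra. }
  destruct (functional_choice (fun x t => ft t = x)) as [h hh].
  { intros x. destruct (Rlt_or_le x (f p)) as [h1|h1].
    { exists (p + (x - f p)). unfold ft, cl. rewrite Rmin_left, Rmax_left; lra. }
    destruct (Rlt_or_le (f q) x) as [h2|h2].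
    { exists (q + (x - f q)). unfold ft, cl. rewrite Rmin_right, Rmax_right; lra. }
    destruct (IVT_closed f p q x) as [t [ht e]]; [lra|easy|lra|].
    exists t. rewrite ft_id; lra. }
  assert (h_in : forall x, f p <= x <= f q -> p <= h x <= q).
  { intros x hx. rewrite <- (ft_id p), <- (ft_id q) in hx by lra.
    split.
    - destruct (Rle_or_lt p (h x)) as [|hl]; [easy|]. apply ft_inc in hl. rewrite hh in hl. lra.
    - destruct (Rle_or_lt (h x) q) as [|hl]; [easy|]. apply ft_inc in hl. rewrite hh in hl. lra. }
  assert (h_inv : forall x, f p <= x <= f q -> f (h x) = x).
  { intros x hx. rewrite <- ft_id by auto. apply hh. }
  assert (h_cont : forall x, continuity_pt h x).
  (* Continuity comes from monotonicity: the values of [ft] at [h x - e] and [h x + e] enclose a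
     neighbourhood of [x]. *)
  { intros x e he.
    assert (l1 : ft (h x - e) < x) by (rewrite <- (hh x) at 2; apply ft_inc; lra).
    assert (l2 : x < ft (h x + e)) by (rewrite <- (hh x) at 1; apply ft_inc; lra).
    exists (Rmin (x - ft (h x - e)) (ft (h x + e) - x)).
    split; [apply Rmin_pos; lra|].
    intros y [_ hy]. simpl in hy |- *. unfold R_dist in *.
    assert (Rabs (y - x) < x - ft (h x - e)) by (eapply Rlt_le_trans; [exact hy|apply Rmin_l]).
    assert (Rabs (y - x) < ft (h x + e) - x) by (eapply Rlt_le_trans; [exact hy|apply Rmin_r]).
    assert (ft (h x - e) < y < ft (h x + e)) as [k1 k2].
    { revert H H0. unfold Rabs. destruct (Rcase_abs (y - x)); lra. }
    apply Rabs_def1.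
    - destruct (Rlt_or_le (h y) (h x + e)); [lra|].
      assert (ft (h x + e) <= ft (h y)); [|rewrite hh in *; lra].
      destruct H1 as [H1 | ->]; [left; now apply ft_inc|lra].
    - destruct (Rlt_or_le (h x - e) (h y)); [lra|].
      assert (ft (h y) <= ft (h x - e)); [|rewrite hh in *; lra].
      destruct H1 as [H1 | ->]; [left; now apply ft_inc|lra]. }
  exists h. split; [auto|].
  intros x hx hn.
  assert (fpq : f p < f q) by (apply hinc; lra).
  assert (ehp : h (f p) = p /\ h (f q) = q).
  { split.
    - destruct (Rtotal_order (h (f p)) p) as [l|[e|l]]; [|easy|];
        apply ft_inc in l; rewrite hh, ft_id in l; lra.
    - destruct (Rtotal_order (h (f q)) q) as [l|[e|l]]; [|easy|];
        apply ft_inc in l; rewrite hh, ft_id in l; lra. }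
  destruct ehp as [ep eq].
  assert (Prf : forall t, h (f p) <= t <= h (f q) -> derivable_pt f t).
  { rewrite ep, eq. intros t ht. exists (Derive f t).
    apply is_derive_Reals, Derive_correct, hd, ht. }
  assert (Pi : h (f p) <= h x <= h (f q)).
  { rewrite ep, eq. apply h_in. lra. }
  assert (dv : derive_pt f (h x) (Prf (h x) Pi) = Derive f (h x)).
  { symmetry. apply is_derive_unique, is_derive_Reals. apply derive_pt_eq_1 with (Prf (h x) Pi). reflexivity. }
  apply is_derive_Reals. rewrite <- dv.
  replace (/ derive_pt f (h x) (Prf (h x) Pi)) with (1 / derive_pt f (h x) (Prf (h x) Pi))
    by (unfold Rdiv; ring).
  apply (derivable_pt_lim_recip_interv f h (f p) (f q) x); auto.
  rewrite dv. easy.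
Qed.

(** * Orbits above the curve as graphs over x *)

(** Above the curve X' > 0, so X has an inverse [h] and the graph is Z composed with [h]. At an end
    on the curve X' = 0, so there only continuity is claimed. *)
Lemma solution_graph (F g X Z : R -> R) (s1 s2 : R) :
  s1 < s2 -> lienard_solution F g X Z s1 s2 ->
  (forall t, s1 < t < s2 -> F (X t) < Z t) ->
  X s1 < X s2 /\
  exists y : R -> R,
    y (X s1) = Z s1 /\ y (X s2) = Z s2 /\
    (forall x, X s1 <= x <= X s2 -> continuity_pt y x) /\
    (forall x, X s1 < x < X s2 -> F x < y x /\ is_derive y x (- g x / (y x - F x))).
Proof.
  intros hs sol above.
  assert (cX : forall t, s1 <= t <= s2 -> continuity_pt X t).
  { intros t ht. destruct (sol t ht) as [dX _]. exact (is_derive_continuity_pt _ _ _ dX). }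
  assert (inc : forall t u, s1 <= t -> t < u -> u <= s2 -> X t < X u).
  { intros t u h1 h2 h3. apply increasing_of_derive; [easy| |].
    - intros x hx. apply cX. lra.
    - intros x hx. exists (Z x - F (X x)). split; [apply sol; lra|].
      assert (F (X x) < Z x) by (apply above; lra). lra. }
  assert (hX : X s1 < X s2) by (apply inc; lra).
  split; [easy|].
  destruct (increasing_inverse X s1 s2 hs) as [h [h1 h2]].
  { intros t ht. destruct (sol t ht) as [dX _]. eexists. exact dX. }
  { exact inc. }
  assert (inj : forall t u, s1 <= t <= s2 -> s1 <= u <= s2 -> X t = X u -> t = u).
  { intros t u ht hu e. destruct (Rtotal_order t u) as [l|[e'|l]]; [|easy|].
    - assert (X t < X u) by (apply inc; lra). lra.
    - assert (X u < X t) by (apply inc; lra). lra. }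
  exists (fun x => Z (h x)).
  refine (conj _ (conj _ (conj _ _))).
  - f_equal. destruct (h1 (X s1)) as [a1 [a2 _]]; [lra|]. apply inj; lra.
  - f_equal. destruct (h1 (X s2)) as [a1 [a2 _]]; [lra|]. apply inj; lra.
  - intros x hx. destruct (h1 x hx) as [a1 [a2 a3]].
    apply (continuity_pt_comp h Z); [easy|].
    destruct (sol (h x) a1) as [_ dZ]. exact (is_derive_continuity_pt _ _ _ dZ).
  - intros x hx. destruct (h1 x) as [a1 [a2 _]]; [lra|].
    assert (hF : F (X (h x)) < Z (h x)).
    { apply above. split; apply Rnot_le_lt; intros hl.
      + replace (h x) with s1 in a2 by lra. lra.
      + replace (h x) with s2 in a2 by lra. lra. }
    destruct (sol (h x) a1) as [dX dZ].
    assert (D : Derive X (h x) = Z (h x) - F x).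
    { rewrite (is_derive_unique _ _ _ dX), a2. reflexivity. }
    rewrite a2 in *. split; [easy|].
    assert (dh : is_derive h x (/ (Z (h x) - F x))).
    { rewrite <- D. apply h2; [lra|]. rewrite D. lra. }
    replace (- g x / (Z (h x) - F x)) with (scal (/ (Z (h x) - F x)) (- g x)).
    + now apply (is_derive_comp (K := R_AbsRing) (V := R_NormedModule) Z h x).
    + unfold scal; simpl; unfold mult; simpl. field. lra.
Qed.

(* [auto_derive] leaves eta-expanded functions under [Derive]. *)
Ltac eta_Derive :=
  repeat match goal with
  | |- context [Derive (fun t => ?f t) ?x] =>
      progress change (Derive (fun t => f t) x) with (Derive f x)
  end.

(** * The shape of F under (H1) *)

Lemma odd_derive_even (f : R -> R) (x : R) :
  odd_fun f -> ex_derive f x -> Derive f (- x) = Derive f x.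
Proof.
  intros ho hd. apply is_derive_unique.
  assert (D : is_derive (fun t => - f (- t)) (- x) (Derive f x)).
  { auto_derive; [now rewrite Ropp_involutive|]. rewrite Ropp_involutive. eta_Derive. ring. }
  apply (is_derive_ext (fun t => - f (- t))); [|easy].
  intros t. rewrite ho. apply Ropp_involutive.
Qed.

Lemma C1_continuity_pt (f : R -> R) (x : R) :
  Defs.C1 f -> continuity_pt f x.
Proof.
  intros h. apply (is_derive_continuity_pt f x (Derive f x)).
  apply Derive_correct, h.
Qed.

Lemma C1_Derive_continuity_pt (f : R -> R) (x : R) :
  Defs.C1 f -> continuity_pt (Derive f) x.
Proof.
  intros h. apply continuity_pt_filterlim. apply h.
Qed.

(** A nonnegative value of F' on [0, a) would force a positive zero other than a; evenness of F'
    gives the negative side. *)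
Lemma Derive_neg_inner (F g : R -> R) (a x : R) :
  H1 F g a -> - a < x < a -> Derive F x < 0.
Proof.
  intros [oF [_ [cF [_ [_ [d0 [[ha [_ uniq]] _]]]]]]].
  assert (half : forall t, 0 <= t < a -> Derive F t < 0).
  { intros t ht. destruct (Rlt_or_le (Derive F t) 0) as [|pos]; [easy|].
    destruct (IVT_closed (Derive F) 0 t 0) as [z [hz e]]; try lra.
    - intros s _. now apply C1_Derive_continuity_pt.
    - destruct (Req_dec z 0) as [->|]; [lra|].
      assert (z = a) by (apply uniq; lra). lra. }
  intros hx. destruct (Rle_or_lt 0 x); [apply half; lra|].
  rewrite <- (Ropp_involutive x), odd_derive_even; [apply half; lra|easy|apply cF].
Qed.

(** Beyond a the derivative has no zero, hence one sign; if it were negative, F would stay bounded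
    above, against its limit. *)
Lemma Derive_pos_outer (F g : R -> R) (a x : R) :
  H1 F g a -> a < x -> 0 < Derive F x.
Proof.
  intros [_ [_ [cF [_ [_ [_ [[ha [_ uniq]] lim]]]]]]] hx.
  destruct (Rlt_or_le 0 (Derive F x)) as [|neg]; [easy|exfalso].
  assert (all : forall t, a < t -> Derive F t < 0).
  { intros t ht. destruct (Rlt_or_le (Derive F t) 0) as [|pos]; [easy|exfalso].
    destruct (Rle_or_lt x t) as [le|lt].
    - destruct (IVT_closed (Derive F) x t 0) as [z [hz e]]; try lra.
      + intros s _. now apply C1_Derive_continuity_pt.
      + assert (z = a) by (apply uniq; lra). lra.
    - destruct (IVT_closed (fun s => - Derive F s) t x 0) as [z [hz e]]; try lra.
      + intros s _. apply continuity_pt_opp. now apply C1_Derive_continuity_pt.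
      + assert (z = a) by (apply uniq; lra). lra. }
  apply is_lim_spec in lim. destruct (lim (F x)) as [N hN].
  set (t := Rmax x N + 1).
  assert (x < t /\ N < t) as [h1 h2].
  { unfold t, Rmax. destruct (Rle_dec x N); lra. }
  specialize (hN t h2).
  assert (- F x <= - F t); [|lra].
  apply (nondecreasing_of_derive (fun s => - F s)); [lra| |].
  - intros s _. apply continuity_pt_opp. now apply C1_continuity_pt.
  - intros s hs. exists (- Derive F s). split.
    + apply (is_derive_opp (K := R_AbsRing) (V := R_NormedModule) F).
      apply Derive_correct, cF.
    + specialize (all s). lra.
Qed.

Lemma decreasing_inner (F g : R -> R) (a x y : R) :
  H1 F g a -> - a <= x -> x < y -> y <= a -> F y < F x.
Proof.
  intros h hx hxy hy.
  assert (cF : Defs.C1 F) by apply h.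
  assert (- F x < - F y); [|lra].
  apply (increasing_of_derive (fun s => - F s)); [lra| |].
  - intros s _. apply continuity_pt_opp. now apply C1_continuity_pt.
  - intros s hs. exists (- Derive F s). split.
    + apply (is_derive_opp (K := R_AbsRing) (V := R_NormedModule) F).
      apply Derive_correct, cF.
    + assert (Derive F s < 0); [|lra]. apply (Derive_neg_inner F g a); [easy|lra].
Qed.

Lemma increasing_outer (F g : R -> R) (a x y : R) :
  H1 F g a -> a <= x -> x < y -> F x < F y.
Proof.
  intros h hx hxy.
  assert (cF : Defs.C1 F) by apply h.
  apply increasing_of_derive; [lra| |].
  - intros s _. now apply C1_continuity_pt.
  - intros s hs. exists (Derive F s). split.
    + apply Derive_correct, cF.
    + apply (Derive_pos_outer F g a); [easy|lra].
Qed.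

Lemma odd_fun_0 (f : R -> R) : odd_fun f -> f 0 = 0.
Proof.
  intros h. specialize (h 0). rewrite Ropp_0 in h. lra.
Qed.

(** F(c) = -F(a) > 0, while F is negative on (0, a]. *)
Lemma c_gt_a (F g : R -> R) (a c : R) : H1 F g a -> is_c F a c -> a < c /\ 0 < F c.
Proof.
  intros h [hc e].
  assert (oF : odd_fun F) by apply h.
  assert (ha : 0 < a) by apply h.
  assert (F0 := odd_fun_0 F oF).
  assert (F a < F 0) by (apply (decreasing_inner F g a); [easy|lra..]).
  assert (ea := oF a).
  split; [|lra].
  apply Rnot_le_lt. intros le.
  assert (F c < F 0) by (apply (decreasing_inner F g a); [easy|lra..]).
  lra.
Qed.

(** F falls from F(-a) = F(c) to F(a) and climbs back to F(c). This keeps V - F positive on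
    [-a, c]. *)
Lemma F_le_on (F g : R -> R) (a c x : R) :
  H1 F g a -> is_c F a c -> - a <= x <= c -> F x <= F c.
Proof.
  intros h hc hx. destruct (c_gt_a F g a c h hc) as [hac _].
  destruct hc as [_ e].
  destruct (Rle_or_lt x a) as [hl|hl].
  - destruct (Req_dec x (- a)) as [->|]; [lra|].
    left. rewrite e. apply (decreasing_inner F g a); [easy|lra..].
  - destruct (Req_dec x c) as [->|]; [lra|].
    left. apply (increasing_outer F g a); [easy|lra..].
Qed.

(** * Auxiliary functions along an orbit *)

(* Along the graph y of an orbit, the derivative of y - k ln (k + y - F) has the sign of k F' - g. *)
Lemma lyapunov_nondecreasing (F g y : R -> R) (k p q : R) :
  p <= q -> 0 < k -> Defs.C1 F ->
  (forall x, p <= x <= q -> continuity_pt y x /\ F x <= y x) ->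
  (forall x, p < x < q -> F x < y x /\ is_derive y x (- g x / (y x - F x)) /\
                          g x <= k * Derive F x) ->
  y p - k * ln (k + y p - F p) <= y q - k * ln (k + y q - F q).
Proof.
  intros hpq hk cF hc hd.
  apply (nondecreasing_of_derive (fun x => y x - k * ln (k + y x - F x))); [easy| |].
  - intros x hx. destruct (hc x hx) as [h1 h2].
    apply continuity_pt_minus; [easy|].
    apply continuity_pt_mult; [apply continuity_pt_const; now intros ? ?|].
    apply (continuity_pt_comp (fun x => k + y x - F x) ln).
    + apply continuity_pt_minus; [|now apply C1_continuity_pt].
      apply continuity_pt_plus; [apply continuity_pt_const; now intros ? ?|easy].
    + apply derivable_continuous_pt. exists (/ (k + y x - F x)).
      apply derivable_pt_lim_ln. lra.
  - intros x hx. destruct (hd x hx) as [h1 [h2 h3]].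
    exists ((k * Derive F x - g x) / (k + y x - F x)). split.
    + auto_derive.
      * repeat apply conj; [eexists; eassumption|eexists; eassumption|apply cF|lra|easy].
      * eta_Derive. rewrite (is_derive_unique _ _ _ h2). field. lra.
    + apply Rdiv_le_0_compat; lra.
Qed.

(** At a fixed level s = F(x) the derivative in y is (y - s) / (k + y - s), so comparing these
    values compares heights. *)
Lemma lyapunov_increasing (k s y1 y2 : R) :
  0 < k -> s <= y1 -> y1 < y2 ->
  y1 - k * ln (k + y1 - s) < y2 - k * ln (k + y2 - s).
Proof.
  intros hk h1 h2.
  apply (increasing_of_derive (fun y => y - k * ln (k + y - s))); [easy| |].
  - intros y hy. apply is_derive_continuity_pt with (1 - k / (k + y - s)).
    auto_derive; [lra|field; lra].
  - intros y hy. exists ((y - s) / (k + y - s)). split.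
    + auto_derive; [lra|field; lra].
    + apply Rdiv_lt_0_compat; lra.
Qed.

(** Since 1 - (V - y) / (V - F) = (y - F) / (V - F), the terms in y' add up to -g / (V - F) and
    cancel P'. Only the derivative of 1 / (V - F) survives. *)
Lemma potential_derive (F g y P : R -> R) (V x : R) :
  ex_derive F x -> F x < V -> F x < y x ->
  is_derive P x (g x / (V - F x)) -> is_derive y x (- g x / (y x - F x)) ->
  is_derive (fun t => P t + y t + (V - y t) ^ 2 / (2 * (V - F t))) x
    ((V - y x) ^ 2 * Derive F x / (2 * (V - F x) ^ 2)).
Proof.
  intros dF hV hy hP dy.
  auto_derive.
  - repeat apply conj; try (eexists; eassumption); try easy. lra.
  - eta_Derive. rewrite (is_derive_unique _ _ _ hP), (is_derive_unique _ _ _ dy).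
    field. repeat split; lra.
Qed.

Lemma potential_continuity_pt (F y P : R -> R) (V x : R) :
  continuity_pt F x -> F x < V -> continuity_pt P x -> continuity_pt y x ->
  continuity_pt (fun t => P t + y t + (V - y t) ^ 2 / (2 * (V - F t))) x.
Proof.
  intros cF hV cP cy.
  apply continuity_pt_plus; [now apply continuity_pt_plus|].
  apply (continuity_pt_div (fun t => (V - y t) ^ 2) (fun t => 2 * (V - F t))); [| |lra].
  - apply (continuity_pt_comp (fun t => V - y t) (fun u => u ^ 2)).
    + apply continuity_pt_minus; [apply continuity_pt_const; now intros ? ?|easy].
    + apply derivable_continuous_pt, derivable_pt_pow.
  - apply continuity_pt_mult; [apply continuity_pt_const; now intros ? ?|].
    apply continuity_pt_minus; [apply continuity_pt_const; now intros ? ?|easy].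
Qed.

(** * The primitive P of g / (V - F) and its inequalities *)

Lemma continuous_primitive (f : R -> R) (p q : R) :
  (forall x, continuity_pt f x) ->
  exists P : R -> R, (forall x, is_derive P x (f x)) /\ P q - P p = RInt f p q.
Proof.
  intros hc.
  assert (hc' : forall x, continuous f x).
  { intros x. apply continuity_pt_filterlim, hc. }
  exists (fun x => RInt f p x). split.
  - intros x. apply (is_derive_RInt f _ p x); [|apply hc'].
    apply filter_forall. intros z.
    apply (RInt_correct (V := R_CompleteNormedModule)).
    apply (ex_RInt_continuous (V := R_CompleteNormedModule)). intros; apply hc'.
  - rewrite RInt_point. unfold zero; simpl. ring.
Qed.

(** The vanishing of the integral enters the proof only as P(-a) = P(c). *)
Lemma I_int_primitive (F g : R -> R) (a c v : R) :
  H1 F g a -> is_c F a c -> 0 < v -> I_int F g c v (- a) c = 0 ->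
  exists P : R -> R, P (- a) = P c /\
    forall x, - a <= x <= c -> is_derive P x (g x / (v + F c - F x)).
Proof.
  intros h hc hv hI.
  assert (cF : Defs.C1 F) by apply h. assert (cg : Defs.C1 g) by apply h.
  assert (hac : - a < c).
  { destruct (c_gt_a F g a c h hc). assert (0 < a) by apply h. lra. }
  (* The cut-off at [v] makes the integrand continuous on the whole line. *)
  set (D := fun x => ((v + F c - F x) + v + Rabs (F c - F x)) / 2).
  assert (hD : forall x, 0 < D x).
  { intros x. unfold D. assert (H := Rle_abs (- (F c - F x))). rewrite Rabs_Ropp in H. lra. }
  assert (eD : forall x, - a <= x <= c -> D x = v + F c - F x).
  { intros x hx. unfold D. rewrite Rabs_right; [lra|].
    assert (F x <= F c) by (apply (F_le_on F g a); easy). lra. }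
  assert (cc : forall r x, continuity_pt (fun _ : R => r) x).
  { intros r x. apply continuity_pt_const. now intros ? ?. }
  destruct (continuous_primitive (fun x => g x / D x) (- a) c) as [P [hP eP]].
  { intros x. apply (continuity_pt_div g D).
    - now apply C1_continuity_pt.
    - unfold D, Rdiv. apply continuity_pt_mult; [|apply cc].
      apply continuity_pt_plus.
      + apply continuity_pt_plus; [|apply cc].
        apply continuity_pt_minus; [apply cc|now apply C1_continuity_pt].
      + apply (continuity_pt_comp (fun x => F c - F x) Rabs); [|apply Rcontinuity_abs].
        apply continuity_pt_minus; [apply cc|now apply C1_continuity_pt].
    - apply Rgt_not_eq, hD. }
  exists P. split.
  - assert (RInt (fun x => g x / D x) (- a) c = 0); [|lra].
    (* The integrand of [I_int] has the opposite denominator, so the two integrals differ by a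
       sign. *)
    rewrite <- Ropp_0, <- hI. unfold I_int.
    rewrite <- (RInt_opp (V := R_CompleteNormedModule)).
    + apply RInt_ext. rewrite Rmin_left, Rmax_right by lra. intros x hx.
      assert (F x <= F c) by (apply (F_le_on F g a); [easy..|lra]).
      rewrite eD by lra. unfold opp; simpl. field. lra.
    + apply (ex_RInt_continuous (V := R_CompleteNormedModule)).
      rewrite Rmin_left, Rmax_right by lra. intros x hx.
      assert (F x <= F c) by (apply (F_le_on F g a); [easy..|lra]).
      apply continuity_pt_filterlim.
      apply (continuity_pt_div g (fun s => F s - F c - v)); [now apply C1_continuity_pt| |lra].
      apply continuity_pt_minus; [|apply cc].
      apply continuity_pt_minus; [now apply C1_continuity_pt|apply cc].
  - intros x hx. rewrite <- eD by easy. apply hP.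
Qed.

(** P + k ln (V - F) has derivative (g - k F') / (V - F), and its logarithmic terms agree at [p] and
    [q]. *)
Lemma primitive_gap (F g P : R -> R) (k V p q r s : R) :
  Defs.C1 F -> 0 < k -> p <= r -> r < s -> s <= q -> F p = F q ->
  (forall x, p <= x <= q -> F x < V /\ is_derive P x (g x / (V - F x)) /\ k * Derive F x <= g x) ->
  (forall x, r < x < s -> k * Derive F x < g x) ->
  P p < P q.
Proof.
  intros cF hk h1 h2 h3 e H Hs.
  set (Q := fun x => P x + k * ln (V - F x)).
  assert (dQ : forall x, p <= x <= q -> is_derive Q x ((g x - k * Derive F x) / (V - F x))).
  { intros x hx. destruct (H x hx) as [a1 [a2 a3]]. unfold Q. auto_derive.
    - repeat apply conj; [eexists; eassumption|apply cF|lra|easy].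
    - eta_Derive. rewrite (is_derive_unique _ _ _ a2). field. lra. }
  assert (cQ : forall x, p <= x <= q -> continuity_pt Q x).
  { intros x hx. eapply is_derive_continuity_pt, dQ, hx. }
  assert (wk : forall u v, p <= u -> u <= v -> v <= q -> Q u <= Q v).
  { intros u v k1 k2 k3. apply nondecreasing_of_derive; [easy| |].
    - intros x hx. apply cQ. lra.
    - intros x hx. eexists. split; [apply dQ; lra|].
      destruct (H x) as [a1 [a2 a3]]; [lra|]. apply Rdiv_le_0_compat; lra. }
  assert (Q r < Q s).
  { apply increasing_of_derive; [easy| |].
    - intros x hx. apply cQ. lra.
    - intros x hx. eexists. split; [apply dQ; lra|].
      destruct (H x) as [a1 [a2 a3]]; [lra|]. specialize (Hs x hx).
      apply Rdiv_lt_0_compat; lra. }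
  assert (Q p <= Q r) by (apply wk; lra).
  assert (Q s <= Q q) by (apply wk; lra).
  unfold Q in *. rewrite e in *. lra.
Qed.

(** The derivative of P + y^2 / (2 V) is g (-F) (V - y) / (V (V - F) (y - F)), a product of
    nonnegative factors. *)
Lemma orbit_below_axis (F g y P : R -> R) (V p q : R) :
  p <= q -> 0 < V -> Defs.C1 F ->
  (forall x, p <= x <= q -> continuity_pt y x /\ continuity_pt P x) ->
  (forall x, p < x < q -> F x <= 0 /\ F x < y x /\ y x <= V /\ 0 <= g x /\
     is_derive P x (g x / (V - F x)) /\ is_derive y x (- g x / (y x - F x))) ->
  P p + y p ^ 2 / (2 * V) <= P q + y q ^ 2 / (2 * V).
Proof.
  intros hpq hV cF hc hd.
  apply (nondecreasing_of_derive (fun x => P x + y x ^ 2 / (2 * V))); [easy| |].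
  - intros x hx. destruct (hc x hx) as [h1 h2].
    apply continuity_pt_plus; [easy|]. unfold Rdiv.
    apply continuity_pt_mult; [|apply continuity_pt_const; now intros ? ?].
    apply (continuity_pt_comp y (fun u => u ^ 2)); [easy|].
    apply derivable_continuous_pt, derivable_pt_pow.
  - intros x hx. destruct (hd x hx) as [h1 [h2 [h3 [h4 [h5 h6]]]]].
    exists (g x * (- F x) * (V - y x) / (V * (V - F x) * (y x - F x))). split.
    + auto_derive.
      * repeat apply conj; try easy; eexists; eassumption.
      * eta_Derive. rewrite (is_derive_unique _ _ _ h5), (is_derive_unique _ _ _ h6).
        field. repeat split; lra.
    + apply Rdiv_le_0_compat.
      * apply Rmult_le_pos; [apply Rmult_le_pos|]; lra.
      * repeat apply Rmult_lt_0_compat; lra.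
Qed.

(** * The two orbit graphs, the reflection tau, and the threshold from (H2) *)

Lemma is_Y_graph (F g : R -> R) (x0 y0 x y : R) :
  is_Y F g x0 y0 x y -> x0 <> x ->
  exists Y : R -> R, Y x0 = y0 /\ Y x = y /\
    (forall s, Rmin x0 x <= s <= Rmax x0 x -> continuity_pt Y s) /\
    (forall s, Rmin x0 x < s < Rmax x0 x ->
       F s < Y s /\ is_derive Y s (- g s / (Y s - F s))).
Proof.
  intros [_ [_ [X [Z [t0 [t1 [sol [e0 [f0 [e1 [f1 above]]]]]]]]]]] ne.
  subst x0 y0 x y.
  destruct (Rtotal_order t0 t1) as [l|[e|l]].
  - rewrite Rmin_left, Rmax_right in sol, above by lra.
    destruct (solution_graph F g X Z t0 t1 l sol above) as [lt [Y [h1 [h2 [h3 h4]]]]].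
    exists Y. rewrite Rmin_left, Rmax_right by lra. tauto.
  - now subst t1.
  - rewrite Rmin_right, Rmax_left in sol, above by lra.
    destruct (solution_graph F g X Z t1 t0 l sol above) as [lt [Y [h1 [h2 [h3 h4]]]]].
    exists Y. rewrite Rmin_right, Rmax_left by lra. tauto.
Qed.

(** [tau] is F followed by the inverse of F on [a, c]. As F > F(a) on [-a, 0], it avoids a, where F'
    vanishes. *)
Lemma reflection (F g : R -> R) (a c : R) :
  H1 F g a -> is_c F a c ->
  exists tau : R -> R, tau (- a) = c /\
    (forall x, - a <= x <= 0 -> a < tau x <= c /\ F (tau x) = F x /\ continuity_pt tau x) /\
    (forall x, - a < x < 0 -> is_derive tau x (Derive F x / Derive F (tau x))) /\
    (forall x y, - a <= x -> x <= y -> y <= 0 -> tau y <= tau x).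
Proof.
  intros h hc. destruct (c_gt_a F g a c h hc) as [hac hM].
  assert (cF : Defs.C1 F) by apply h.
  assert (ha : 0 < a) by apply h.
  assert (F0 : F 0 = 0) by (apply odd_fun_0, h).
  assert (Fa : F a < 0).
  { rewrite <- F0. apply (decreasing_inner F g a); [easy|lra..]. }
  destruct (increasing_inverse F a c hac) as [k [k1 k2]].
  { intros x _. apply cF. }
  { intros x y h1 h2 h3. now apply (increasing_outer F g a). }
  assert (inj : forall x y, a <= x -> a <= y -> F x <= F y -> x <= y).
  { intros x y h1 h2 h3. apply Rnot_lt_le. intros l.
    assert (F y < F x) by now apply (increasing_outer F g a). lra. }
  assert (rg : forall x, - a <= x <= 0 -> F a < F x <= F c).
  { intros x hx. split.
    - apply (decreasing_inner F g a); [easy|lra..].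
    - apply (F_le_on F g a); [easy..|lra]. }
  assert (base : forall x, - a <= x <= 0 ->
            a < k (F x) <= c /\ F (k (F x)) = F x /\ continuity_pt (fun x => k (F x)) x).
  { intros x hx. destruct (rg x hx) as [r1 r2].
    destruct (k1 (F x)) as [b1 [b2 b3]]; [lra|].
    split; [|split; [easy|]].
    - split; [|easy]. destruct (Req_dec (k (F x)) a) as [e|]; [|lra].
      rewrite e in b2. lra.
    - apply (continuity_pt_comp F k); [now apply C1_continuity_pt|easy]. }
  exists (fun x => k (F x)). split; [|split; [exact base|split]].
  - destruct (base (- a)) as [b1 [b2 _]]; [lra|]. destruct hc as [_ e].
    apply Rle_antisym; apply inj; lra.
  - intros x hx. destruct (base x) as [b1 [b2 _]]; [lra|].
    assert (p : 0 < Derive F (k (F x))) by (apply (Derive_pos_outer F g a); [easy|lra]).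
    apply (is_derive_comp (K := R_AbsRing) (V := R_NormedModule) k F x).
    + apply k2; [|lra]. split; [apply rg; lra|].
      destruct hc as [_ ->]. apply (decreasing_inner F g a); [easy|lra..].
    + apply Derive_correct, cF.
  - intros x y h1 h2 h3.
    destruct (base x) as [b1 [b2 _]]; [lra|]. destruct (base y) as [d1 [d2 _]]; [lra|].
    apply inj; [lra..|]. rewrite b2, d2.
    destruct h2 as [h2 | ->]; [|lra].
    left. apply (decreasing_inner F g a); [easy|lra..].
Qed.

Lemma odd_neg (g : R -> R) (x : R) :
  odd_fun g -> (forall x, 0 < x -> 0 < g x) -> x < 0 -> g x < 0.
Proof.
  intros og pg hx. specialize (pg (- x)). rewrite og in pg. lra.
Qed.

(** [x0] is chosen so that g / F' has the same value [k] at [x0] and [tau x0]. Since F' / g is odd,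
    (H2) then yields the inequalities on both sides of 0. *)
Lemma ratio_threshold (F g tau : R -> R) (a c : R) :
  H1 F g a -> is_c F a c -> H2 F g c -> tau (- a) = c ->
  (forall x, - a <= x <= 0 -> a < tau x <= c /\ F (tau x) = F x /\ continuity_pt tau x) ->
  (forall x y, - a <= x -> x <= y -> y <= 0 -> tau y <= tau x) ->
  exists x0 k, - a < x0 < 0 /\ 0 < k /\
    (forall x, - a < x < x0 -> g x <= k * Derive F x) /\
    (forall x, tau x0 < x < c -> g x <= k * Derive F x) /\
    (forall x, x0 <= x <= tau x0 -> k * Derive F x <= g x).
Proof.
  intros h hc h2 t1 t2 t3.
  destruct (c_gt_a F g a c h hc) as [hac hM].
  assert (cF : Defs.C1 F) by apply h. assert (cg : Defs.C1 g) by apply h.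
  assert (oF : odd_fun F) by apply h. assert (og : odd_fun g) by apply h.
  assert (ha : 0 < a) by apply h.
  assert (pg : forall x, 0 < x -> 0 < g x) by apply h.
  assert (ng : forall x, x < 0 -> g x < 0) by (intros; now apply odd_neg).
  assert (g0 : g 0 = 0) by now apply odd_fun_0.
  assert (F'0 : Derive F 0 < 0) by apply h.
  assert (even : forall x, Derive F (- x) = Derive F x).
  { intros x. apply odd_derive_even; [easy|apply cF]. }
  assert (posF' : forall x, - a <= x <= 0 -> 0 < Derive F (tau x)).
  { intros x hx. apply (Derive_pos_outer F g a); [easy|now apply t2]. }
  (* (H2) with denominators cleared. *)
  assert (mono : forall x y, 0 < x -> x <= y -> y < c ->
            Derive F x * g y <= Derive F y * g x).
  { intros x y k1 k2 k3. specialize (h2 x y k1 k2 k3).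
    assert (px : 0 < g x) by (apply pg; lra). assert (py : 0 < g y) by (apply pg; lra).
    apply (Rmult_le_compat_r (g x * g y)) in h2; [|nra].
    replace (Derive F x / g x * (g x * g y)) with (Derive F x * g y) in h2 by (field; lra).
    replace (Derive F y / g y * (g x * g y)) with (Derive F y * g x) in h2 by (field; lra).
    easy. }
  (* A zero of [N] equates the two ratios. It changes sign because F'(-a) = 0 leaves F'(c) g(-a) <
     0, and g(0) = 0 leaves -F'(0) g(tau 0) > 0. *)
  set (N := fun x => Derive F (tau x) * g x - Derive F x * g (tau x)).
  assert (Na : N (- a) < 0).
  { unfold N. rewrite even. replace (Derive F a) with 0 by (symmetry; apply h).
    assert (g (- a) < 0) by (apply ng; lra). assert (0 < Derive F (tau (- a))) by (apply posF'; lra).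
    nra. }
  assert (N0 : 0 < N 0).
  { unfold N. rewrite g0. assert (0 < g (tau 0)); [|nra].
    apply pg. destruct (t2 0); lra. }
  destruct (IVT_closed N (- a) 0 0) as [x0 [hx0 e]]; [lra| |lra|].
  { intros x hx. destruct (t2 x hx) as [_ [_ ct]].
    apply continuity_pt_minus; apply continuity_pt_mult.
    - apply (continuity_pt_comp tau (Derive F)); [easy|now apply C1_Derive_continuity_pt].
    - now apply C1_continuity_pt.
    - now apply C1_Derive_continuity_pt.
    - apply (continuity_pt_comp tau g); [easy|now apply C1_continuity_pt]. }
  assert (ne1 : x0 <> - a) by (intros ->; lra).
  assert (ne2 : x0 <> 0) by (intros ->; lra).
  assert (tlt : tau x0 < c).
  { destruct (t2 x0 hx0) as [b1 [b2 _]].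
    destruct (Req_dec (tau x0) c) as [e'|]; [|lra].
    rewrite e' in b2. destruct hc as [_ ec].
    assert (F x0 < F (- a)) by (apply (decreasing_inner F g a); [easy|lra..]). lra. }
  unfold N in e. clear N Na N0.
  assert (pF := posF' x0 hx0).
  destruct (t2 x0 hx0) as [b1 _].
  assert (gt : 0 < g (tau x0)) by (apply pg; lra).
  assert (gx0 : g x0 < 0) by (apply ng; lra).
  set (T := tau x0) in *. set (k := g T / Derive F T).
  assert (ek : k * Derive F T = g T) by (unfold k; field; lra).
  assert (pk : 0 < k) by (unfold k; now apply Rdiv_lt_0_compat).
  assert (ek0 : k * Derive F x0 = g x0).
  { apply (Rmult_eq_reg_r (Derive F T)); [|lra].
    replace (k * Derive F x0 * Derive F T) with (Derive F x0 * (k * Derive F T)) by ring.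
    rewrite ek. lra. }
  clearbody k.
  exists x0, k. fold T. split; [lra|]. split; [easy|]. split; [|split].
  (* Parity carries points left of 0 to (0, c), where [mono] applies. *)
  - intros x hx. assert (m := mono (- x0) (- x) ltac:(lra) ltac:(lra) ltac:(lra)).
    rewrite !even, !og in m.
    assert (g x < 0) by (apply ng; lra).
    apply (Rmult_le_reg_r (- g x0)); [lra|]. rewrite <- ek0 at 1.
      apply (Rmult_le_compat_l k) in m; lra.
  - intros x hx. assert (m := mono T x ltac:(lra) ltac:(lra) ltac:(lra)).
    apply (Rmult_le_reg_r (g T)); [lra|]. rewrite <- ek at 1.
      apply (Rmult_le_compat_l k) in m; lra.
  - intros x hx. destruct (Rtotal_order x 0) as [l|[->|l]].
    + assert (m := mono (- x) (- x0) ltac:(lra) ltac:(lra) ltac:(lra)).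
      rewrite !even, !og in m.
      apply (Rmult_le_reg_r (- g x0)); [lra|]. rewrite <- ek0 at 2.
      apply (Rmult_le_compat_l k) in m; lra.
    + rewrite g0. nra.
    + assert (m := mono x T ltac:(lra) ltac:(lra) ltac:(lra)).
      apply (Rmult_le_reg_r (g T)); [lra|]. rewrite <- ek at 2.
      apply (Rmult_le_compat_l k) in m; lra.
Qed.

(** * Comparison of the two heights at x = 0 *)

Theorem theorem1p4 (F g : R -> R) (a c v0 Yl Yr : R)
  (hH1 : H1 F g a)
  (hc : is_c F a c)
  (hH2 : H2 F g c)
  (hv0 : 0 < v0) (hI : I_int F g c v0 (- a) c = 0)
  (hYl : is_Y F g (- a) (F c) 0 Yl)
  (hYr : is_Y F g c (F c) 0 Yr)
  (hmin : Rmin Yl Yr <= v0 + F c) :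
  Yl >= Yr.
Proof.
  apply Rnot_lt_ge. intros lt.
  rewrite Rmin_left in hmin by lra.
  destruct (c_gt_a F g a c hH1 hc) as [hac hM].
  assert (cF : Defs.C1 F) by apply hH1.
  assert (ha : 0 < a) by apply hH1.
  assert (pg : forall x, 0 < x -> 0 < g x) by apply hH1.
  assert (ng : forall x, x < 0 -> g x < 0) by (intros; apply odd_neg; [apply hH1|easy..]).
  assert (F0 : F 0 = 0) by (apply odd_fun_0, hH1).
  assert (FM : forall x, - a <= x <= c -> F x <= F c).
  { intros x hx. now apply (F_le_on F g a). }
  assert (ec : F c = F (- a)) by apply hc.
  destruct (I_int_primitive F g a c v0 hH1 hc hv0 hI) as [P [eP dP]].
  destruct (is_Y_graph F g _ _ _ _ hYl) as [yl [l1 [l2 [l3 l4]]]]; [lra|].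
  destruct (is_Y_graph F g _ _ _ _ hYr) as [yr [r1 [r2 [r3 r4]]]]; [lra|].
  rewrite Rmin_left, Rmax_right in l3, l4 by lra.
  rewrite Rmin_right, Rmax_left in r3, r4 by lra.
  clear hYl hYr hI.
  destruct (reflection F g a c hH1 hc) as [tau [t1 [t2 [t3 t4]]]].
  destruct (ratio_threshold F g tau a c hH1 hc hH2 t1 t2 t4)
    as [x0 [k [hx0 [hk [k1 [k2 k3]]]]]].
  set (V := v0 + F c) in *.
  assert (cP : forall x, - a <= x <= c -> continuity_pt P x).
  { intros x hx. eapply is_derive_continuity_pt. now apply dP. }
  (* The left graph rises to its height [Yl] at 0, which is at most [V]. For [yr] such a bound will
     only come from its comparison with [yl]. *)
  assert (yl_le : forall x, - a <= x <= 0 -> yl x <= V).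
  { intros x hx. assert (yl x <= yl 0); [|lra].
    apply nondecreasing_of_derive; [lra| |].
    - intros s hs. apply l3. lra.
    - intros s hs. destruct (l4 s) as [p1 p2]; [lra|]. eexists. split; [exact p2|].
      assert (g s < 0) by (apply ng; lra). apply Rdiv_le_0_compat; lra. }
  assert (yr_dec : forall x y, 0 <= x -> x <= y -> y <= c -> yr y <= yr x).
  { intros x y h1 h2 h3. apply Ropp_le_cancel.
    apply (nondecreasing_of_derive (fun s => - yr s)); [easy| |].
    - intros s hs. apply continuity_pt_opp, r3. lra.
    - intros s hs. destruct (r4 s) as [p1 p2]; [lra|].
      exists (- (- g s / (yr s - F s))). split.
      + now apply (is_derive_opp (K := R_AbsRing) (V := R_NormedModule) yr).
      + assert (0 < g s) by (apply pg; lra).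
        replace (- (- g s / (yr s - F s))) with (g s / (yr s - F s)) by (field; lra).
        apply Rdiv_le_0_compat; lra. }
  assert (cD : forall x, - a <= x <= 0 -> continuity_pt (fun s => yl s - yr (tau s)) x).
  { intros x hx. destruct (t2 x hx) as [b1 [b2 b3]].
    apply continuity_pt_minus; [now apply l3|].
    apply (continuity_pt_comp tau yr); [easy|]. apply r3. lra. }
  assert (outer : forall x, - a <= x <= x0 -> 0 <= yl x - yr (tau x)).
  { intros x hx. destruct (t2 x) as [b1 [b2 _]]; [lra|].
    assert (b4 : tau x0 <= tau x) by (apply t4; lra).
    assert (gel : F x <= yl x).
    { destruct (Req_dec x (- a)) as [->|]; [lra|]. left. apply l4. lra. }
    assert (ger : F (tau x) <= yr (tau x)).
    { destruct (Req_dec (tau x) c) as [->|]; [lra|]. left. apply r4. lra. }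
    assert (E1 : yl (- a) - k * ln (k + yl (- a) - F (- a)) <= yl x - k * ln (k + yl x - F x)).
    { apply (lyapunov_nondecreasing F g yl k); [lra|easy..| |].
      - intros s hs. split; [apply l3; lra|].
        destruct (Req_dec s (- a)) as [->|]; [lra|]. left. apply l4. lra.
      - intros s hs. destruct (l4 s) as [p1 p2]; [lra|].
        split; [easy|]. split; [easy|]. apply k1. lra. }
    assert (E2 : yr (tau x) - k * ln (k + yr (tau x) - F (tau x)) <= yr c - k * ln (k + yr c - F c)).
    { apply (lyapunov_nondecreasing F g yr k); [lra|easy..| |].
      - intros s hs. split; [apply r3; lra|].
        destruct (Req_dec s c) as [->|]; [lra|]. left. apply r4. lra.
      - intros s hs. destruct (r4 s) as [p1 p2]; [lra|].
        split; [easy|]. split; [easy|]. apply k2. lra. }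
    (* Both graphs end on the curve at level F(c), so [E1] and [E2] share the value F(c) - k ln k
       and chain together. *)
    rewrite l1, <- ec in E1. rewrite r1, b2 in E2.
    destruct (Rle_or_lt (yr (tau x)) (yl x)) as [|l]; [lra|].
    assert (E3 := lyapunov_increasing k (F x) _ _ hk gel l). lra. }
  destruct (first_zero (fun s => yl s - yr (tau s)) x0 0) as [m [hm [inner stop]]].
  { lra. }
  { intros x hx. apply cD. lra. }
  { apply outer. lra. }
  assert (order : forall x, - a <= x <= m -> yr (tau x) <= yl x).
  { intros x hx. destruct (Rle_or_lt x x0).
    - assert (0 <= yl x - yr (tau x)); [apply outer|]; lra.
    - assert (0 <= yl x - yr (tau x)); [apply inner|]; lra. }
  set (Phi := fun y t => P t + y t + (V - y t) ^ 2 / (2 * (V - F t)) : R).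
  assert (key : Phi yr (tau m) <= Phi yl m).
  { assert (start : Phi yl (- a) - Phi yr (tau (- a)) = 0).
    (* Here P(-a) = P(c) is used; the heights and the values of F also agree. *)
    { unfold Phi. rewrite t1, l1, r1, eP, <- ec. ring. }
    assert (Phi yl (- a) - Phi yr (tau (- a)) <= Phi yl m - Phi yr (tau m)); [|lra].
    apply (nondecreasing_of_derive (fun x => Phi yl x - Phi yr (tau x))); [lra| |].
    - intros x hx. destruct (t2 x) as [b1 [b2 b3]]; [lra|].
      assert (F x <= F c) by (apply FM; lra).
      apply continuity_pt_minus.
      + apply potential_continuity_pt; [now apply C1_continuity_pt|unfold V; lra| |].
        * apply cP. lra.
        * apply l3. lra.
      + apply (continuity_pt_comp tau (Phi yr)); [easy|].
        apply potential_continuity_pt; [now apply C1_continuity_pt|unfold V; lra| |].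
        * apply cP. lra.
        * apply r3. lra.
    - intros x hx. destruct (t2 x) as [b1 [b2 _]]; [lra|].
      assert (F x <= F c) by (apply FM; lra).
      destruct (l4 x) as [p1 p2]; [lra|].
      assert (tc : tau x < c).
      { destruct (Req_dec (tau x) c) as [e|]; [|lra].
        assert (F x < F (- a)) by (apply (decreasing_inner F g a); [easy|lra..]).
        rewrite e in b2. lra. }
      destruct (r4 (tau x)) as [q1 q2]; [lra|].
      assert (pF : 0 < Derive F (tau x)) by (apply (Derive_pos_outer F g a); [easy|lra]).
      assert (nF : Derive F x < 0) by (apply (Derive_neg_inner F g a); [easy|lra]).
      assert (ord := order x ltac:(lra)). assert (yV := yl_le x ltac:(lra)).
      assert (dl := potential_derive F g yl P V x (proj1 (cF x)) ltac:(unfold V; lra) p1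
                      (dP x ltac:(lra)) p2).
      assert (dr := potential_derive F g yr P V (tau x) (proj1 (cF _)) ltac:(unfold V; lra) q1
                      (dP (tau x) ltac:(lra)) q2).
      assert (dt := t3 x ltac:(lra)).
      (* The factor F'(x) / F'(tau x) from [tau] turns F'(tau x) into F'(x), so both derivatives
         share the weight F'(x) / (2 (V - F(x))^2). *)
      assert (drt := is_derive_comp (K := R_AbsRing) (V := R_NormedModule)
                       (Phi yr) tau x _ _ dr dt).
      eexists. split.
      + apply (is_derive_minus (K := R_AbsRing) (V := R_NormedModule)); [exact dl|exact drt].
      + unfold minus, plus, opp, scal; simpl; unfold mult; simpl. rewrite b2.
        (* Difference of the squares (V - yr)^2 and (V - yl)^2, times -F' > 0; both factors are
           nonnegative because yr(tau x) <= yl(x) <= V. *)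
        replace (_ + _) with
          (- Derive F x * ((yl x - yr (tau x)) * (2 * V - yl x - yr (tau x)))
             / (2 * (V - F x) ^ 2)).
        * apply Rdiv_le_0_compat.
          -- apply Rmult_le_pos; [lra|]. apply Rmult_le_pos; lra.
          -- assert (0 < V - F x) by (unfold V; lra). nra.
        * field. split; [unfold V; lra|lra]. }
  destruct (t2 m) as [b1 [b2 _]]; [lra|].
  (* Puts [m, tau m] inside [x0, tau x0], where [k3] holds. *)
  assert (b4 : tau m <= tau x0) by (apply t4; lra).
  destruct (t2 x0) as [b5 _]; [lra|].
  destruct stop as [-> | meet].
  - assert (below : forall x, 0 < x -> x < tau 0 -> F x <= 0).
    { intros x h1 h2. left. destruct (Rle_or_lt x a).
      - rewrite <- F0. apply (decreasing_inner F g a); [easy|lra..].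
      - rewrite <- F0, <- b2. apply (increasing_outer F g a); [easy|lra..]. }
    assert (ord := order 0 ltac:(lra)).
    (* Such a point exists because yr(tau 0) <= Yl < Yr = yr(0); from there on [yr] is at most
       [V]. *)
    destruct (IVT_closed (fun s => - yr s) 0 (tau 0) (- Yl)) as [xi [hxi e]]; [lra| |lra|].
    { intros s hs. apply continuity_pt_opp, r3. lra. }
    assert (nxi : xi <> 0) by (intros ->; lra).
    assert (P0 : P 0 < P xi).
    { apply increasing_of_derive; [lra| |].
      - intros s hs. apply cP. lra.
      - intros s hs. eexists. split; [apply dP; lra|].
        assert (F s <= F c) by (apply FM; lra).
        apply Rdiv_lt_0_compat; [apply pg|unfold V]; lra. }
    assert (gap : P xi + yr xi ^ 2 / (2 * V) <= P (tau 0) + yr (tau 0) ^ 2 / (2 * V)).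
    { apply (orbit_below_axis F g); [lra|unfold V; lra|easy| |].
      - intros s hs. split; [apply r3|apply cP]; lra.
      - intros s hs. destruct (r4 s) as [q1 q2]; [lra|].
        split; [apply below; lra|]. split; [easy|]. split.
        + assert (yr s <= yr xi) by (apply yr_dec; lra). lra.
        + split; [left; apply pg; lra|]. split; [|easy]. apply dP. lra. }
    unfold Phi in key. rewrite b2, F0, l2 in key.
    replace (yr xi) with Yl in gap by lra.
    assert (hV : 0 < V) by (unfold V; lra).
    (* At F = 0 the potential is P + y^2 / (2 V) up to the constant V / 2, so [key] and [gap]
       combine to P(xi) <= P(0). *)
    assert (sq : forall y, y + (V - y) ^ 2 / (2 * (V - 0)) = V / 2 + y ^ 2 / (2 * V)).
    { intros y. field. lra. }
    rewrite !Rplus_assoc, !sq in key. lra.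
  - assert (gap : P m < P (tau m)).
    (* Strictness comes from (0, a), where g > 0 > F'. *)
    { apply (primitive_gap F g P k V m (tau m) 0 a); try easy; try lra.
      - intros x hx. assert (F x <= F c) by (apply FM; lra).
        split; [unfold V; lra|]. split; [apply dP; lra|]. apply k3. lra.
      - intros x hx. assert (0 < g x) by (apply pg; lra).
        assert (Derive F x < 0) by (apply (Derive_neg_inner F g a); [easy|lra]). nra. }
    unfold Phi in key. rewrite b2 in key.
    (* With equal heights and equal F, [key] reduces to P(tau m) <= P(m). *)
    replace (yr (tau m)) with (yl m) in key by lra. lra.
Qed.
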